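(* Let $\mathcal{G}$ be the class of all finite groups and $\mathcal{C}$ the class of all finite cyclic groups. Let $\mathcal{S}$ be a class of finite groups such that $\mathcal{C}\subsetneq\mathcal{S}\subsetneq\mathcal{G}$. Then the set $$\operatorname{Im}\psi''|_{\mathcal{S}}=\lbrace \psi''(G)\mid G\in\mathcal{S}\rbrace$$ is dense in $[0,1]$.
   Context: For a finite group $G$ and $x\in G$, $o(x)$ denotes the order of $x$. The sum of element orders of $G$ is $\psi(G)=\sum_{x\in G}o(x)$, and $\psi''(G)=\frac{\psi(G)}{|G|^2}$. One has $\psi''(G)\in(0,1]$ for every finite group $G$. For a subclass $\mathcal{S}$ of $\mathcal{G}$ (the class of all finite groups satisfying a certain property), $\psi''|_{\mathcal{S}}$ is the restriction of $\psi''$ to $\mathcal{S}$. Density in $[0,1]$ is with respect to the usual topology of $\mathbb{R}$, i.e. the closure of the set is $[0,1]$. *)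

(* Defs.v *)
From mathcomp Require Import all_boot all_order all_algebra all_fingroup all_solvable.
From mathcomp Require Import all_classical all_reals all_analysis.
Set Implicit Arguments.
Unset Strict Implicit.
Unset Printing Implicit Defensive.
Import numFieldNormedType.Exports.
Local Open Scope ring_scope.
Local Open Scope classical_set_scope.

(* Classes are not required to be closed under isomorphism. *)
Definition group_class := forall gT : finGroupType, {group gT} -> Prop.

Definition all_groups : group_class := fun _ _ => True.

Definition cyclic_groups : group_class := fun _ G => cyclic G.

Definition subclass (A B : group_class) : Prop :=
  forall (gT : finGroupType) (G : {group gT}), A gT G -> B gT G.

Definition proper_subclass (A B : group_class) : Prop :=
  subclass A B /\ ~ subclass B A.

Definition psi (gT : finGroupType) (G : {group gT}) : nat :=
  (\sum_(x in G) #[x]%g)%N.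

Definition psi'' (R : realType) (gT : finGroupType) (G : {group gT}) : R :=
  (psi G)%:R / #|G|%:R ^+ 2.

Definition Im_psi'' (R : realType) (S : group_class) : set R :=
  [set r | exists (gT : finGroupType) (G : {group gT}),
             S gT G /\ r = psi'' R G].
Arguments Im_psi'' R S _ : clear implicits.

(* Density of [A] in the subset [B], where [A] is contained in [B] and [B] is
   closed; the library's [dense] is density in the whole space. *)
Definition dense_in (T : topologicalType) (A B : set T) : Prop :=
  closure A = B.

(* Main.v *)
(* psi'' is multiplicative on direct products of groups of coprime orders, so a
   cyclic group whose order is the product of the primes in [M, N) has
   psi'' equal to the product of the factors 1 - 1/p + 1/p^2 over these primes.
   As the factors tend to 1 while, by divergence of the harmonic series, the
   products tend to 0 when N grows, the first partial product below a target t
   is within 1/M of t. *)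

Require Import Defs.
From mathcomp Require Import all_boot all_order all_algebra all_fingroup all_solvable.
From mathcomp Require Import all_classical all_reals all_analysis.
From mathcomp Require Import ring lra.
Import Order.TTheory GRing.Theory Num.Theory.
Import numFieldNormedType.Exports.
Local Open Scope ring_scope.
Local Open Scope classical_set_scope.

Lemma big_nat_recr_cond (T : Type) (idx : T) (op : Monoid.law idx)
    (m n : nat) (P : pred nat) (F : nat -> T) : (m <= n)%N ->
  \big[op/idx]_(m <= i < n.+1 | P i) F i =
  op (\big[op/idx]_(m <= i < n | P i) F i) (if P n then F n else idx).
Proof. by move=> mn; rewrite !(big_mkcond P) big_nat_recr. Qed.

(** * Values of [psi''], in particular on cyclic groups of squarefree order *)

Lemma psi''_ge0 (R : realType) (gT : finGroupType) (G : {group gT}) :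
  0 <= psi'' R G.
Proof. by rewrite divr_ge0 ?exprn_ge0. Qed.

Lemma psi''_le1 (R : realType) (gT : finGroupType) (G : {group gT}) :
  psi'' R G <= 1.
Proof.
rewrite ler_pdivrMr ?exprn_gt0 ?ltr0n ?cardG_gt0// mul1r -natrX ler_nat.
rewrite -mulnn -sum_nat_const; apply: leq_sum => x xG.
by rewrite dvdn_leq ?cardG_gt0 ?order_dvdG.
Qed.

Lemma order_pair (gT rT : finGroupType) (x : gT) (y : rT) :
  coprime #[x]%g #[y]%g -> #[(x, y)]%g = (#[x]%g * #[y]%g)%N.
Proof.
have -> : (x, y) = (pairg1 rT x * pair1g gT y)%g.
  by congr pair; rewrite /= ?mulg1 ?mul1g.
have ox : #[pairg1 rT x]%g = #[x]%g.
  by rewrite (order_injm (injm_pairg1 gT rT)) ?inE.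
have oy : #[pair1g gT y]%g = #[y]%g.
  by rewrite (order_injm (injm_pair1g gT rT)) ?inE.
move=> co; rewrite orderM ?ox ?oy//.
by congr pair; rewrite /= ?mulg1 ?mul1g.
Qed.

Lemma psi_setX (gT rT : finGroupType) (G : {group gT}) (H : {group rT}) :
  coprime #|G| #|H| -> psi (setX_group G H) = (psi G * psi H)%N.
Proof.
move=> coGH; rewrite /psi big_distrlr/= pair_big/=.
apply: eq_big => [[x y]|[x y]]; first by rewrite finset.in_setX.
rewrite finset.in_setX => /andP[/= xG yH]; apply: order_pair.
exact: coprime_dvdl (order_dvdG xG) (coprime_dvdr (order_dvdG yH) coGH).
Qed.

Lemma psi''_setX (R : realType) (gT rT : finGroupType)
    (G : {group gT}) (H : {group rT}) :
  coprime #|G| #|H| -> psi'' R (setX_group G H) = psi'' R G * psi'' R H.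
Proof.
move=> coGH; rewrite /psi'' psi_setX//= cardsX !natrM exprMn invfM.
by rewrite mulrACA.
Qed.

Lemma cyclic_setX (gT rT : finGroupType) (G : {group gT}) (H : {group rT}) :
  cyclic G -> cyclic H -> coprime #|G| #|H| -> cyclic (setX_group G H).
Proof.
move=> cycG cycH coGH; rewrite (cyclic_dprod (setX_dprod G H)).
- by rewrite !cardsX !cards1 muln1 mul1n.
- by rewrite /= -morphim_pairg1 (injm_cyclic (injm_pairg1 _ _)) ?finset.subsetT.
- by rewrite /= -morphim_pair1g (injm_cyclic (injm_pair1g _ _)) ?finset.subsetT.
Qed.

(** All elements except the identity have order [p = #|G|], so [psi G = 1 + (p - 1) p]. *)
Lemma psi''_prime (R : realType) (gT : finGroupType) (G : {group gT}) :
  prime #|G| -> psi'' R G = 1 - #|G|%:R^-1 + #|G|%:R^-1 ^+ 2.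
Proof.
move=> pG; have p_neq0 : #|G|%:R != 0 :> R by rewrite pnatr_eq0 -lt0n cardG_gt0.
rewrite /psi''; have -> : psi G = (1 + #|G|.-1 * #|G|)%N.
  rewrite /psi (bigD1 1%g)//= order1; congr (_ + _)%N.
  rewrite (eq_bigr (fun=> #|G|)).
    rewrite sum_nat_const; congr (_ * _)%N.
    rewrite [in RHS](cardsD1 1%g G) group1 /=.
    by apply: eq_card => x; rewrite !inE andbC.
  move=> x /andP[xG x1]; have := order_dvdG xG.
  by apply/prime_nt_dvdP; rewrite ?order_eq1.
rewrite natrD natrM -subn1 natrB ?cardG_gt0//.
by field.
Qed.

(** The order is carried along for the induction: it is a product of primes below [N], hence coprime
    to [N] when the factor ['Z_N] is added. *)
Lemma cyclic_psi''_prod (R : realType) (M N : nat) :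
  exists (gT : finGroupType) (G : {group gT}),
    [/\ cyclic G, #|G| = (\prod_(M <= p < N | prime p) p)%N &
     psi'' R G = \prod_(M <= p < N | prime p) (1 - p%:R^-1 + p%:R^-1 ^+ 2)].
Proof.
elim: N => [|N [gT [G [cycG cardG psiG]]]].
  rewrite !big_geq//; exists 'I_1, 1%G.
  by rewrite cyclic1 cards1 /psi'' /psi big_set1 order1 cards1 expr1n divr1.
have [leMN|ltNM] := leqP M N; last first.
  rewrite !big_geq ?(ltnW ltNM)// in cardG psiG *.
  by exists gT, G.
rewrite !big_nat_recr_cond//=; case: ifP => primeN; last first.
  by exists gT, G; rewrite muln1 mulr1.
have cardZ : #|Zp N| = N by rewrite card_Zp ?prime_gt0.
have coGN : coprime #|G| #|Zp N|.
  rewrite cardG cardZ big_mkcond big_nat.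
  apply: (big_ind (coprime^~ N)) => [|a b|p /andP[_ ltpN]]; rewrite ?coprime1n//.
    by rewrite coprimeMl => -> ->.
  case: ifP => [primep|_]; rewrite ?coprime1n//.
  by rewrite prime_coprime// dvdn_prime2// neq_ltn ltpN.
exists (gT * 'Z_N)%type, (setX_group G (Zp_group N)); split.
- by rewrite cyclic_setX// prime_cyclic// cardZ.
- by rewrite /= cardsX cardG cardZ.
- by rewrite psi''_setX// psiG psi''_prime/= cardZ.
Qed.

(** * Sieving the harmonic sum, and decay of products over primes *)

(** Division by [p] is injective on the multiples of [p] and, by the stability of [P], sends the
    indices on the left to indices [m] on the right, with [1/n = (1/p)(1/m)]. *)
Lemma sum_inv_multiples_le (R : numFieldType) (P : pred nat) (p N : nat) :
    (0 < p)%N -> (forall m, P (p * m)%N -> P m) ->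
  \sum_(1 <= n < N.+1 | P n && (p %| n)%N) n%:R^-1
    <= p%:R^-1 * \sum_(1 <= m < N.+1 | P m) m%:R^-1 :> R.
Proof.
move=> p_gt0 Pdiv; pose s := [seq m <- index_iota 1 N.+1 | P m].
pose t := [seq (n %/ p)%N | n <- index_iota 1 N.+1 & P n && (p %| n)%N].
have t_uniq : uniq t.
  rewrite map_inj_in_uniq ?filter_uniq ?iota_uniq// => m n.
  rewrite !mem_filter => /andP[/andP[_ pm] _] /andP[/andP[_ pn] _] eqmn.
  by rewrite -(divnK pm) eqmn divnK.
have sub_ts : {subset t <= s}.
  move=> _ /mapP[n + ->]; rewrite !mem_filter !mem_index_iota.
  move=> /andP[/andP[Pn /dvdnP[m n_eq]] /andP[n_gt0 ltnN]].
  move: Pn n_gt0 ltnN; rewrite n_eq mulnK// mulnC => /Pdiv-> /=.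
  rewrite muln_gt0 => /andP[_ ->] /=.
  by apply: leq_ltn_trans; rewrite leq_pmull.
rewrite mulr_sumr -[leRHS]big_filter -/s [leRHS](bigID (mem t))/=.
have -> : \sum_(1 <= n < N.+1 | P n && (p %| n)%N) n%:R^-1 =
    \sum_(m <- s | m \in t) p%:R^-1 * m%:R^-1 :> R.
  rewrite -(big_filter s) [RHS](perm_big t); last first.
    apply: uniq_perm => //; first by rewrite /s !filter_uniq ?iota_uniq.
    by move=> m; rewrite mem_filter; case mt: (m \in t) => //=; rewrite sub_ts.
  rewrite big_map big_filter; apply: eq_bigr => n /andP[_ pn].
  by rewrite -invfM -natrM mulnC divnK.
by rewrite lerDl sumr_ge0// => m _; rewrite mulr_ge0 ?invr_ge0.
Qed.

(* Euler's bound without unique factorization: discarding the multiples of p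
   from a set stable under division by p costs at most a 1/p share of the sum. *)
Lemma harmonic_sieve (R : numFieldType) (s : seq nat) (N : nat) :
    all (ltn 1) s ->
  (\sum_(1 <= n < N.+1) n%:R^-1) * \prod_(p <- s) (1 - p%:R^-1) <=
  \sum_(1 <= n < N.+1 | all (fun p => ~~ (p %| n)%N) s) n%:R^-1 :> R.
Proof.
elim: s => [_|p s IHs /= /andP[p_gt1 /IHs {}IHs]].
  by rewrite big_nil mulr1.
have p_gt0 : (0 < p)%N := ltnW p_gt1.
have p1 : 0 <= 1 - p%:R^-1 :> R.
  by rewrite subr_ge0 invf_le1 ?ler1n ?ltr0n.
rewrite big_cons mulrCA mulrC; apply: le_trans (ler_wpM2r p1 IHs) _.
rewrite mulrBr mulr1 lerBlDr [leLHS](bigID (fun n => p %| n)%N)/= addrC.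
rewrite lerD//; first by under [leRHS]eq_bigl do rewrite andbC.
rewrite mulrC.
apply: (@sum_inv_multiples_le R (fun n => all (fun q => ~~ (q %| n)%N) s)) => //.
move=> m; apply: sub_all => q.
by apply: contra => /dvdn_mull; apply.
Qed.

Lemma harmonic_unbounded (R : realType) (A : R) :
  exists N : nat, A < \sum_(1 <= n < N.+1) n%:R^-1.
Proof.
apply: contrapT => /forallNP HA; apply: (@dvg_harmonic R).
apply: nondecreasing_is_cvgn.
  by apply/nondecreasing_seqP => n; rewrite /series/= big_nat_recr//= lerDl.
exists A => _ [n _ <-]; rewrite leNgt; apply/negP => /=.
(* The harmonic series is indexed from 0 with terms [1/(n+1)], hence the shift. *)
by rewrite /series/= -(big_add1 _ _ 0 n.+1 xpredT (fun n => n%:R^-1)); apply/HA.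
Qed.

(** With [x = 1/p], the difference of the two sides factors with nonnegative factors once
    [x <= 1/3]. At [p = 2] the inequality fails, since [9/16 > 1/2]. *)
Lemma psi''_factor_sqr_le (R : realFieldType) (p : nat) :
  (3 <= p)%N -> (1 - p%:R^-1 + p%:R^-1 ^+ 2) ^+ 2 <= 1 - p%:R^-1 :> R.
Proof.
move=> p3; have p_gt0 : (0 : R) < p%:R by rewrite ltr0n (leq_trans _ p3).
have : p%:R^-1 <= 3%:R^-1 :> R by rewrite lef_pV2 ?posrE ?ler_nat.
have : 0 <= p%:R^-1 :> R by rewrite invr_ge0 ltW.
move: (p%:R^-1) => x x0 x3.
rewrite -subr_ge0.
have -> : 1 - x - (1 - x + x ^+ 2) ^+ 2 =
    x * ((1 - 3 * x) + x ^+ 2 * (2 - x)) by ring.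
by rewrite mulr_ge0// addr_ge0 ?mulr_ge0 ?sqr_ge0//; lra.
Qed.

Lemma prime_prod_small (R : realType) (M : nat) (t : R) :
    (3 <= M)%N -> 0 < t ->
  exists N : nat,
    \prod_(M <= p < N | prime p) (1 - p%:R^-1 + p%:R^-1 ^+ 2) < t.
Proof.
move=> M3 t0; pose g (p : nat) : R := 1 - p%:R^-1.
have g_gt0 p : prime p -> 0 < g p.
  by move=> /prime_gt1 p1; rewrite subr_gt0 invf_lt1 ?ltr1n ?ltr0n// ltnW.
pose c := \prod_(0 <= p < M | prime p) g p.
have c0 : 0 < c by rewrite prodr_gt0.
(* With [h] the harmonic sum up to [N] and [q] the product of [g] over the primes in [[M, K)], the
   sieve will give [h c q <= 1]; then [h > 1 / (c t^2)] forces [q < t^2]. *)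
have [N HN] := @harmonic_unbounded R (c * t ^+ 2)^-1.
pose K := maxn M N.+1; exists K.
have leMK : (M <= K)%N by rewrite leq_maxl.
(* Squaring makes each factor at most 1 - 1/p, to which the sieve applies. *)
rewrite -(@ltr_pXn2r _ 2) ?nnegrE ?(ltW t0)//; last first.
  apply: prodr_ge0 => p _; rewrite addr_ge0 ?sqr_ge0//.
  (* Primality of [p] has been dropped, so [p = 0] occurs, with inverse 0 by convention. *)
  by case: p => [|p]; rewrite ?invr0 ?subr0// subr_ge0 invf_le1 ?ler1n ?ltr0n.
rewrite -prodrXl.
apply: (@le_lt_trans _ _ (\prod_(M <= p < K | prime p) g p)).
  rewrite big_nat_cond [leRHS]big_nat_cond.
  apply: ler_prod => p /andP[/andP[leMp _] _].
  by rewrite sqr_ge0 psi''_factor_sqr_le// (leq_trans M3).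
have := @harmonic_sieve R [seq p <- index_iota 0 K | prime p] N.
rewrite big_filter (big_cat_nat (leq0n M) leMK)/= -/c => sieve.
set h := \sum_(1 <= n < N.+1) n%:R^-1 in HN sieve *.
set q := \prod_(M <= p < K | prime p) g p in sieve *.
have {sieve} hcq : h * (c * q) <= 1.
  apply: le_trans (sieve _) _.
    by apply/allP => p; rewrite mem_filter => /andP[/prime_gt1].
  (* Since [K > N], each [n] from 2 to [N] has its least prime divisor in the sieving list, so at
     most the term [n = 1] survives. *)
  clear sieve HN h q; case: N @K leMK => [|N] K leMK; first by rewrite big_geq.
  rewrite big_mkcond big_ltn// big_nat big1 => [|n /andP[n_gt1 leNn]].
    by rewrite /= addr0; case: ifP; rewrite ?invr1.
  have pdiv_s : pdiv n \in [seq p <- index_iota 0 K | prime p].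
    rewrite mem_filter pdiv_prime// mem_index_iota leq_max !ltnS.
    by rewrite (leq_trans (pdiv_leq (ltnW n_gt1))) ?orbT.
  by case: ifP => // /allP/(_ _ pdiv_s); rewrite pdiv_dvd.
have ct0 : 0 < c * t ^+ 2 by rewrite mulr_gt0 ?exprn_gt0.
have h0 : 0 < h by apply: lt_trans HN; rewrite invr_gt0.
have : h * (c * q) < h * (c * t ^+ 2).
  by apply: le_lt_trans hcq _; rewrite -ltr_pdivrMr// div1r.
by rewrite ltr_pM2l// ltr_pM2l.
Qed.

(** * Approximation of a target by products, and density *)

Lemma prime_prod_approx (R : realType) (t e : R) : 0 < t <= 1 -> 0 < e ->
  exists M N : nat, t - e <=
    \prod_(M <= p < N | prime p) (1 - p%:R^-1 + p%:R^-1 ^+ 2) <= t.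
Proof.
move=> /andP[t0 t1] e0.
(* The bound 3 serves the squared-factor estimate; exceeding [1/e] makes every [1/k] with [k >= M]
   smaller than [e]. *)
pose M := maxn 3 (Num.truncn e^-1).+1; exists M.
have Me k : (M <= k)%N -> k%:R^-1 < e.
  move=> leMk; rewrite invf_plt ?posrE//; last first.
    by rewrite ltr0n (leq_trans _ leMk)// leq_max.
  apply: lt_le_trans (truncnS_gt _) _.
  by rewrite ler_nat (leq_trans _ leMk)// leq_maxr.
have [N0 /ltW small] := @prime_prod_small R M t (leq_maxl _ _) t0.
pose u N : R := \prod_(M <= p < N | prime p) (1 - p%:R^-1 + p%:R^-1 ^+ 2).
case: (ex_minnP (ex_intro (fun N => u N <= t) N0 small)) => -[|k] ukt mink.
  exists 0%N; rewrite -/(u 0%N) ukt andbT /u big_geq//.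
  by rewrite (le_trans _ t1)// gerBl ltW.
exists k.+1; rewrite -/(u k.+1) ukt andbT.
have utk : t < u k by rewrite ltNge; apply/negP => /mink; rewrite ltnn.
(* If [k < M], then [u k] and [u k.+1] are both empty products, contradicting
   [u k.+1 <= t < u k]. *)
have [leMk|ltkM] := leqP M k; last first.
  move: utk ukt; rewrite /u !big_geq ?(ltnW ltkM)// => /lt_le_trans lt1 /lt1.
  by rewrite ltxx.
rewrite /u big_nat_recr_cond//= -/(u k); case: ifP => _; last first.
  by rewrite mulr1 (le_trans _ (ltW utk))// gerBl ltW.
have ke := Me _ leMk; have : 0 <= k%:R^-1 :> R by rewrite invr_ge0.
move: (k%:R^-1) ke => x xe x0.
have f0 : 0 <= 1 - x + x ^+ 2 by nra.
(* As [t <= 1], [t (1 - x + x^2) >= t - x >= t - e]. *)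
apply: le_trans (ler_wpM2r f0 (ltW utk)); nra.
Qed.

Theorem corollary1p3 (R : realType) (S : group_class)
  (hCS : proper_subclass cyclic_groups S)
  (hSG : proper_subclass S all_groups) :
  dense_in (Im_psi'' R S) `[0, 1]%classic.
Proof.
rewrite /dense_in eqEsubset; split.
  rewrite [X in _ `<=` X](closure_id _).1; last exact: interval_closed.
  apply: closure_subset => _ [gT [G [_ ->]]] /=.
  by rewrite in_itv/= psi''_ge0 psi''_le1.
move=> x /=; rewrite in_itv/= => /andP[x0 x1] B /nbhs_ballP[e /= e0 xeB].
(* The products approximate positive targets only, so [x] is raised to a positive [t] in
   [[x, x + e/2]], which covers [x = 0]. *)
pose t := Num.max x (Num.min 1 (e / 2)).
have t01 : 0 < t <= 1.
  by rewrite lt_max lt_min ltr01 divr_gt0// orbT ge_max x1 ge_min lexx.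
have [M [N]] := @prime_prod_approx R t (e / 2) t01 (divr_gt0 e0 (ltr0n _ 2)).
have [gT [G [cycG _ <-]]] := cyclic_psi''_prod R M N => /andP[tG Gt].
exists (psi'' R G); split.
  by exists gT, G; split => //; apply: hCS.1.
apply: xeB; rewrite /ball/= ltr_distlC.
have xt : x <= t by rewrite le_max lexx.
have tx : t <= x + e / 2.
  by rewrite ge_max lerDl divr_ge0 ?(ltW e0)//= ge_min lerDr x0 orbT.
by apply/andP; split; lra.
Qed.
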